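(* Let $A \in M_{2n\times 2n}(\mathbb{C})$ be diagonalizable. (1) Assume that $A$ is per-Hermitian. Then $A$ is perplectic diagonalizable if and only if for any real eigenvalue $\lambda \in \sigma(A)$ and some basis $v_1,\dots,v_m$ of the corresponding eigenspace, the matrix $V^H R_{2n} V$ with $V = [\,v_1\;\cdots\;v_m\,]$ has equally many positive and negative real eigenvalues. (2) Assume that $A$ is perskew-Hermitian. Then $A$ is perplectic diagonalizable if and only if for any purely imaginary eigenvalue $\lambda \in \sigma(A)$ and some basis $v_1,\dots,v_m$ of the corresponding eigenspace, the matrix $V^H R_{2n} V$ with $V = [\,v_1\;\cdots\;v_m\,]$ has equally many positive and negative real eigenvalues.
   Context: $M_{m\times m}(\mathbb{C})$ is the space of complex $m\times m$ matrices, $A^H=\overline{A}^T$ is the Hermitian transpose, and $\sigma(A)$ is the set of eigenvalues of $A$. $R_n$ is the $n\times n$ matrix with ones on the antidiagonal and zeros elsewhere, and $R_{2n} = \begin{bmatrix} 0 & R_n \\ R_n & 0\end{bmatrix}$. A matrix $A \in M_{2n\times 2n}(\mathbb{C})$ is per-Hermitian if $R_{2n} A^H R_{2n} = A$, and perskew-Hermitian if $R_{2n} A^H R_{2n} = -A$. A matrix $S \in M_{2n\times 2n}(\mathbb{C})$ is perplectic if it is invertible with $R_{2n} S^H R_{2n} = S^{-1}$ (equivalently $S^H R_{2n} S = R_{2n}$). $A$ is perplectic diagonalizable if there is a perplectic $S$ such that $S^{-1}AS$ is diagonal. The number $0$ is regarded as both real and purely imaginary when it occurs as an eigenvalue $\lambda$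 of $A$. The matrix $V^H R_{2n}V$ is Hermitian, so its eigenvalues are real; they are counted with multiplicity. *)

(* Defs.v *)
From mathcomp Require Import all_boot all_order all_algebra.
From mathcomp Require Import complex.

Set Implicit Arguments.
Unset Strict Implicit.
Unset Printing Implicit Defensive.

Import GRing.Theory Num.Theory.
Local Open Scope ring_scope.
Local Open Scope sesquilinear_scope.

(* [A ^t*] is the Hermitian transpose.  The definitions are over any
   algebraically closed numeric field, of which [R[i]] is an instance. *)

Definition flipmx (C : numClosedFieldType) (n : nat) : 'M[C]_n :=
  \matrix_(i, j) (j == rev_ord i)%:R.

Definition per_hermitian (C : numClosedFieldType) (n : nat)
    (A : 'M[C]_(n + n)) : Prop :=
  flipmx C (n + n) *m A^t* *m flipmx C (n + n) = A.

Definition perskew_hermitian (C : numClosedFieldType) (n : nat)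
    (A : 'M[C]_(n + n)) : Prop :=
  flipmx C (n + n) *m A^t* *m flipmx C (n + n) = - A.

Definition perplectic (C : numClosedFieldType) (n : nat)
    (S : 'M[C]_(n + n)) : Prop :=
  S \in unitmx /\ flipmx C (n + n) *m S^t* *m flipmx C (n + n) = invmx S.

Definition perplectic_diagonalizable (C : numClosedFieldType) (n : nat)
    (A : 'M[C]_(n + n)) : Prop :=
  exists S : 'M[C]_(n + n), perplectic S /\ is_diag_mx (invmx S *m A *m S).

(* MathComp's [eigenvalue] and [eigenspace] are about row vectors with
   v *m A = a *: v, so column eigenvectors are obtained by transposing. *)
Definition col_eigenvalue (C : numClosedFieldType) (k : nat)
    (A : 'M[C]_k) (a : C) : Prop :=
  eigenvalue A^T a.

Definition eigenbasis (C : numClosedFieldType) (k : nat) (A : 'M[C]_k) (a : C)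
    (m : nat) (V : 'M[C]_(k, m)) : Prop :=
  row_free V^T /\ (V^T :=: eigenspace A^T a)%MS.

(* The roots of the characteristic polynomial, repeated according to their
   multiplicity. *)
Definition spectrum_seq (C : numClosedFieldType) (m : nat) (H : 'M[C]_m) :
    seq C :=
  sval (closed_field_poly_normal (char_poly H)).

(* On a [numClosedFieldType], 0 < x and x < 0 entail that x is real. *)
Definition balanced_spectrum (C : numClosedFieldType) (m : nat)
    (H : 'M[C]_m) : Prop :=
  count (fun x => 0 < x) (spectrum_seq H) =
  count (fun x => x < 0) (spectrum_seq H).

Lemma flipmx_block (C : numClosedFieldType) (n : nat) :
  flipmx C (n + n) = block_mx 0 (flipmx C n) (flipmx C n) 0.
Proof.
apply/matrixP => i j; rewrite !mxE.
case: splitP => i' Ei; rewrite mxE; case: splitP => j' Ej; rewrite !mxE;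
  rewrite -val_eqE /= Ei Ej.
- rewrite (_ : _ == _ = false) //; apply/negbTE; rewrite neq_ltn.
  by rewrite -addnBA // ltn_addr // ltn_ord.
- by rewrite -val_eqE /= -addnBA // eqn_add2l.
- by rewrite -val_eqE /= -addnS subnDl.
- rewrite (_ : _ == _ = false) //; apply/negbTE; rewrite neq_ltn; apply/orP.
  right; rewrite -addnS subnDl (leq_trans _ (leq_addr _ _)) //.
  by rewrite ltn_subrL /= (leq_ltn_trans _ (ltn_ord i')).
Qed.

Lemma spectrum_seqP (C : numClosedFieldType) (m : nat) (H : 'M[C]_m) :
  char_poly H = \prod_(x <- spectrum_seq H) ('X - x%:P).
Proof.
rewrite /spectrum_seq; case: closed_field_poly_normal => s /= {1}->.
by rewrite (monicP (char_poly_monic H)) scale1r.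
Qed.

Lemma eigenbasis_col (C : numClosedFieldType) (k : nat) (A : 'M[C]_k) (a : C)
    (m : nat) (V : 'M[C]_(k, m)) :
  eigenbasis A a V -> A *m V = a *: V.
Proof.
move=> [_ VE]; apply: trmx_inj; rewrite trmx_mul linearZ /=.
by apply/eigenspaceP; rewrite VE.
Qed.

(* Main.v *)
(* Write J for the flip matrix; eigenvectors are handled as rows, i.e. as left
   eigenvectors of B = A^T, with the form [x, y] = x J y^t*.  A is per-Hermitian
   iff B is self-adjoint for this form, so E_a and E_b are orthogonal unless
   b = a^*.  A perplectic diagonalization is, up to reordering, a basis of
   eigenvectors made of two dual totally isotropic halves U and W.  When B is
   diagonalizable, E_a is in perfect duality with E_(a^* ); for a nonreal this
   gives bases U of E_a and W of E_(a^* ), and for a real the spectral theorem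
   turns a balanced Gram matrix into an orthogonal basis with equally many
   vectors p, n of square 1 and -1, paired as p + n and (p - n) / 2.
   Concatenating over the eigenvalues gives the basis.  Conversely, the
   eigenvectors picked from a perplectic basis have as Gram matrix a principal
   submatrix of J, which a diagonal sign matrix conjugates to its opposite, so
   its spectrum is symmetric.  The perskew-Hermitian case follows by passing
   to 'i *: A. *)

Require Import Defs.
From mathcomp Require Import all_boot all_order all_algebra.
From mathcomp Require Import complex reals.
From mathcomp Require Import zify.

Set Implicit Arguments.
Unset Strict Implicit.
Unset Printing Implicit Defensive.

Import Order.TTheory GRing.Theory Num.Theory.

Local Open Scope ring_scope.
Local Open Scope sesquilinear_scope.

(** * Hermitian transposes and Gram matrices of families of rows *)

Definition gram {C : numClosedFieldType} {k} (G : 'M[C]_k) {p q}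
  (X : 'M[C]_(p, k)) (Y : 'M[C]_(q, k)) : 'M[C]_(p, q) := X *m G *m Y^t*.

Section Adjoint.
Context {C : numClosedFieldType}.

Lemma adjmxM {m n p} (X : 'M[C]_(m, n)) (Y : 'M[C]_(n, p)) :
  (X *m Y)^t* = Y^t* *m X^t*.
Proof. by rewrite trmx_mul map_mxM. Qed.

Lemma adjmxZ {m n} (a : C) (X : 'M[C]_(m, n)) : (a *: X)^t* = a^* *: X^t*.
Proof. by rewrite linearZ map_mxZ. Qed.

Lemma adjmx1 n : (1%:M : 'M[C]_n)^t* = 1%:M.
Proof. by rewrite trmx1 map_mx1. Qed.

Lemma adjmx_diag n (d : 'rV[C]_n) :
  (diag_mx d)^t* = diag_mx (map_mx Num.conj d).
Proof. by rewrite tr_diag_mx map_diag_mx. Qed.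

End Adjoint.

Section Gram.
Context {C : numClosedFieldType} {k : nat} {G : 'M[C]_k}.
Hypothesis G_herm : G^t* = G.

Lemma gram_adj {p q} (X : 'M[C]_(p, k)) (Y : 'M[C]_(q, k)) :
  (gram G X Y)^t* = gram G Y X.
Proof. by rewrite /gram !adjmxM trmxCK G_herm mulmxA. Qed.

Lemma gramMl {p p' q} (M : 'M[C]_(p', p)) (X : 'M_(p, k)) (Y : 'M_(q, k)) :
  gram G (M *m X) Y = M *m gram G X Y.
Proof. by rewrite /gram !mulmxA. Qed.

Lemma gramMr {p q q'} (M : 'M[C]_(q', q)) (X : 'M_(p, k)) (Y : 'M_(q, k)) :
  gram G X (M *m Y) = gram G X Y *m M^t*.
Proof. by rewrite /gram adjmxM !mulmxA. Qed.

Lemma gram_col_mx {p1 p2 q1 q2} (X1 : 'M[C]_(p1, k)) (X2 : 'M_(p2, k))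
    (Y1 : 'M_(q1, k)) (Y2 : 'M_(q2, k)) :
  gram G (col_mx X1 X2) (col_mx Y1 Y2) =
  block_mx (gram G X1 Y1) (gram G X1 Y2) (gram G X2 Y1) (gram G X2 Y2).
Proof.
by rewrite /gram mul_col_mx tr_col_mx map_row_mx mul_mx_row !mul_col_mx
           -block_mxEh.
Qed.

Lemma gram_eq0_sub {p q p' q'} (X : 'M[C]_(p, k)) (Y : 'M_(q, k))
    (X' : 'M_(p', k)) (Y' : 'M_(q', k)) :
  (X <= X')%MS -> (Y <= Y')%MS -> gram G X' Y' = 0 -> gram G X Y = 0.
Proof.
by move=> /submxP[M ->] /submxP[N ->] E; rewrite gramMl gramMr E mul0mx mulmx0.
Qed.

Lemma gram_eq0C {p q} (X : 'M[C]_(p, k)) (Y : 'M_(q, k)) :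
  gram G X Y = 0 -> gram G Y X = 0.
Proof. by move=> E; rewrite -gram_adj E trmx0 map_mx0. Qed.

(** Orthogonality becomes inclusion in a kernel, so that the calculus of row spaces handles sums of
    subspaces. *)
Lemma gram_eq0P {p q} (X : 'M[C]_(p, k)) (Y : 'M_(q, k)) :
  reflect (gram G X Y = 0) (X <= kermx (G *m Y^t*))%MS.
Proof. by apply: (iffP sub_kermxP); rewrite /gram mulmxA. Qed.

Lemma gram_eq0_adds {p q1 q2} (X : 'M[C]_(p, k)) (Y1 : 'M_(q1, k))
    (Y2 : 'M_(q2, k)) :
  gram G X Y1 = 0 -> gram G X Y2 = 0 -> gram G X (Y1 + Y2)%MS = 0.
Proof.
move=> /gram_eq0C/gram_eq0P E1 /gram_eq0C/gram_eq0P E2.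
by apply/gram_eq0C/gram_eq0P; rewrite addsmx_sub E1 E2.
Qed.

Lemma gram_eq0_sums {p} (X : 'M[C]_(p, k)) (s : seq C) (F : C -> 'M[C]_k) :
  {in s, forall a, gram G X (F a) = 0} ->
  gram G X (\sum_(a <- s) F a)%MS = 0.
Proof.
elim: s => [|a s IHs] E; first by rewrite big_nil /gram trmx0 map_mx0 mulmx0.
rewrite big_cons; apply: gram_eq0_adds; first by apply: E; rewrite mem_head.
by apply: IHs => b sb; apply: E; rewrite in_cons sb orbT.
Qed.

End Gram.

(** * Hyperbolic pairs: dual totally isotropic families *)

Definition hyperbolic {C : numClosedFieldType} {k} (G : 'M[C]_k) {r}
    (U W : 'M[C]_(r, k)) : Prop :=
  [/\ gram G U U = 0, gram G W W = 0 & gram G U W = 1%:M].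

Section Hyperbolic.
Context {C : numClosedFieldType} {k : nat} {G : 'M[C]_k}.
Hypothesis G_herm : G^t* = G.

(** Up to reversing the rows of [W], this matrix is J; keeping the two halves separate lets families
    be concatenated without reindexing. *)
Lemma hyperbolic_gram {r} (U W : 'M[C]_(r, k)) : hyperbolic G U W ->
  gram G (col_mx U W) (col_mx U W) = block_mx 0 1%:M 1%:M 0.
Proof.
move=> [UU WW UW].
by rewrite gram_col_mx UU WW UW -(gram_adj G_herm U W) UW adjmx1.
Qed.

(** The Gram matrix of the joined family is its own inverse, which exhibits a right inverse of the
    family. *)
Lemma hyperbolic_free {r} (U W : 'M[C]_(r, k)) : hyperbolic G U W ->
  row_free (col_mx U W).
Proof.
move=> /hyperbolic_gram E; apply/row_freeP.
exists (G *m (col_mx U W)^t* *m block_mx 0 1%:M 1%:M 0).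
rewrite !mulmxA -[_ *m _ *m _^t*]/(gram G _ _) E mulmx_block.
by rewrite !(mul0mx, mulmx0, mulmx1, addr0, add0r) -scalar_mx_block.
Qed.

Lemma hyperbolic_nil : hyperbolic G (0 : 'M[C]_(0, k)) (0 : 'M[C]_(0, k)).
Proof. by split; apply/matrixP => -[]. Qed.

Lemma hyperbolic_cat {r1 r2} (U1 W1 : 'M[C]_(r1, k)) (U2 W2 : 'M_(r2, k)) :
  hyperbolic G U1 W1 -> hyperbolic G U2 W2 ->
  gram G (col_mx U1 W1) (col_mx U2 W2) = 0 ->
  hyperbolic G (col_mx U1 U2) (col_mx W1 W2).
Proof.
move=> [UU1 WW1 UW1] [UU2 WW2 UW2]; rewrite gram_col_mx => /eqP.
rewrite -[0]block_mx0 => /eqP/eq_block_mx[UU UW WU WW].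
split; rewrite gram_col_mx.
- by rewrite UU1 UU2 UU (gram_eq0C G_herm UU) // block_mx0.
- by rewrite WW1 WW2 WW (gram_eq0C G_herm WW) // block_mx0.
- by rewrite UW1 UW2 UW (gram_eq0C G_herm WU) // -scalar_mx_block.
Qed.

End Hyperbolic.

(** * Eigenspaces of a self-adjoint matrix *)

Section SelfAdjoint.
Context {C : numClosedFieldType} {k : nat} {G B : 'M[C]_k}.
Hypotheses (G_herm : G^t* = G) (G_unit : G \in unitmx).
Hypothesis B_selfadj : B *m G = G *m B^t*.

(** [X B, Y] = [X, Y B] by self-adjointness, so a [X, Y] = b^* [X, Y]. *)
Lemma gram_eigen {p q} (X : 'M[C]_(p, k)) (Y : 'M_(q, k)) (a b : C) :
  X *m B = a *: X -> Y *m B = b *: Y -> a != b^* -> gram G X Y = 0.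
Proof.
move=> XB YB neq_ab; apply/eqP.
have: a *: gram G X Y == b^* *: gram G X Y.
  rewrite [X in _ == X]scalemxAr -adjmxZ -YB adjmxM mulmxA.
  by rewrite -[_ *m G *m B^t*]mulmxA -B_selfadj mulmxA XB -!scalemxAl.
by rewrite -subr_eq0 -scalerBl scaler_eq0 subr_eq0 (negPf neq_ab).
Qed.

Lemma gram_eigenspace (a b : C) :
  a != b^* -> gram G (eigenspace B a) (eigenspace B b) = 0.
Proof. by apply: gram_eigen; apply/eigenspaceP. Qed.

Hypothesis B_diag : diagonalizable B.

(** The rows of [X] are orthogonal to E_b for b other than a^* by [gram_eigenspace], and to E_{a^*}
    by assumption. These spaces span everything since [B] is diagonalizable, and [G] is
    invertible. *)
Lemma gram_eigen_nondeg {p} (a : C) (X : 'M[C]_(p, k)) :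
  (X <= eigenspace B a)%MS -> gram G X (eigenspace B a^*) = 0 -> X = 0.
Proof.
move=> Xa X0; have /diagonalizablePeigen[rs _ rsP] := B_diag.
have: gram G X (\sum_(r <- rs) eigenspace B r)%MS = 0.
  apply: gram_eq0_sums => // b _; have [->//|neq_ba] := eqVneq b a^*.
  apply: gram_eq0_sub Xa (submx_refl _) _; apply: gram_eigenspace.
  by apply: contraNneq neq_ba => ->; rewrite conjCK.
move=> E; have: gram G X 1%:M = 0.
  by apply: gram_eq0_sub (submx_refl X) _ E; rewrite rsP.
rewrite /gram adjmx1 mulmx1.
by move/(congr1 (mulmx^~ (invmx G))); rewrite mulmxK // mul0mx.
Qed.

(** A linear relation between the rows of the Gram matrix gives a combination of the rows of [X]
    orthogonal to E_{a^*}, which vanishes by nondegeneracy. *)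
Lemma gram_eigen_free {p q} (a : C) (X : 'M[C]_(p, k)) (Y : 'M_(q, k)) :
  row_free X -> (X <= eigenspace B a)%MS -> (eigenspace B a^* <= Y)%MS ->
  row_free (gram G X Y).
Proof.
move=> Xfree Xa Ya; apply: inj_row_free => v; rewrite -gramMl => E.
apply: (row_free_inj Xfree); rewrite mul0mx; apply: (@gram_eigen_nondeg _ a).
  exact: submx_trans (submxMl _ _) Xa.
exact: gram_eq0_sub (submx_refl _) Ya E.
Qed.

(** Both eigenspaces are totally isotropic because a differs from a^*, and they pair perfectly, so
    it remains to choose dual bases. *)
Lemma hyperbolic_nonreal (a : C) : a != a^* ->
  exists r (U W : 'M[C]_(r, k)), [/\ hyperbolic G U W,
    (U <= eigenspace B a)%MS, (W <= eigenspace B a^*)%MS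
    & (eigenspace B a + eigenspace B a^* <= col_mx U W)%MS].
Proof.
move=> neq_a; pose U := row_base (eigenspace B a).
pose Y := row_base (eigenspace B a^*).
have UE : (U :=: eigenspace B a)%MS by apply: eq_row_base.
have YE : (Y :=: eigenspace B a^*)%MS by apply: eq_row_base.
have UY : row_free (gram G U Y).
  by apply: (@gram_eigen_free _ _ a); rewrite ?row_base_free ?UE ?YE.
have YU : row_free (gram G Y U).
  by apply: (@gram_eigen_free _ _ a^*); rewrite ?row_base_free ?conjCK ?UE ?YE.
(* Replacing [Y] by N^t* Y multiplies the Gram matrix on the right by its right inverse [N]. *)
have [N UYN] := row_freeP UY; pose W := N^t* *m Y.
have UW : gram G U W = 1%:M by rewrite gramMr trmxCK UYN.
have Wfree : row_free W.
  rewrite -row_leq_rank; have := mxrankM_maxr (U *m G) (W^t*).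
  by rewrite -[_ *m _]/(gram G _ _) UW mxrank1 mxrank_map mxrank_tr.
have WY : (W <= eigenspace B a^*)%MS by rewrite -YE submxMl.
(* [YU] bounds dim E_{a^*} by dim E_a, the number of rows of the free family [W]. *)
have leW : (eigenspace B a^* <= W)%MS.
  rewrite -(geq_leqif (mxrank_leqif_sup WY)) (eqP Wfree).
  by rewrite -[X in (X <= _)%N](eqP YU) rank_leq_col.
exists _, U, W; split=> //; last by rewrite -addsmxE addsmxS // UE.
  split=> //.
    by apply: (gram_eigen _ _ neq_a); apply/eigenspaceP; rewrite UE.
  by apply: (@gram_eigen _ _ _ _ a^* a^*); rewrite ?conjCK 1?eq_sym //;
     apply/eigenspaceP.
by rewrite UE.
Qed.

End SelfAdjoint.

(** * Spectra, similarity and signs of eigenvalues *)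

Section Spectrum.
Context {C : numClosedFieldType}.

Lemma char_poly_conj {m} (P D : 'M[C]_m) : P \in unitmx ->
  char_poly (invmx P *m D *m P) = char_poly D.
Proof.
move=> Punit; rewrite /char_poly /char_poly_mx !map_mxM /=.
have PV : map_mx polyC (invmx P) *m map_mx polyC P = 1%:M.
  by rewrite -map_mxM mulVmx // map_mx1.
rewrite -[X in \det X](_ : map_mx polyC (invmx P) *m
  ('X%:M - map_mx polyC D) *m map_mx polyC P = _); last first.
  by rewrite mulmxBr mulmxBl scalar_mxC -[X in X - _]mulmxA PV mulmx1.
by rewrite !det_mulmx mulrAC -det_mulmx PV det1 mul1r.
Qed.

Lemma spectrum_seq_conj {m} (P : 'M[C]_m) (d : 'rV_m) : P \in unitmx ->
  perm_eq (spectrum_seq (invmx P *m diag_mx d *m P))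
          [seq d 0 i | i <- enum 'I_m].
Proof.
move=> Punit; apply: prod_XsubC_eq; rewrite -spectrum_seqP char_poly_conj //.
rewrite char_poly_trig ?diag_mx_is_trig // big_image /=.
by apply: eq_bigr => i _; rewrite mxE eqxx.
Qed.

(** This turns balance into an equality between the numbers of positive and negative entries of a
    diagonal form. *)
Lemma count_spectrum_seq {m} (P : 'M[C]_m) (d : 'rV_m) (p : pred C) :
  P \in unitmx ->
  count p (spectrum_seq (invmx P *m diag_mx d *m P)) = #|[pred i | p (d 0 i)]|.
Proof.
move=> Punit; rewrite (permP (spectrum_seq_conj d Punit)) count_map.
rewrite -size_filter cardE /enum_mem -filter_predI; congr size.
by apply: eq_filter => i; rewrite /= andbT.
Qed.

Lemma hermitian_spectral {m} (H : 'M[C]_m) : H^t* = H ->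
  exists (P : 'M_m) (d : 'rV_m), [/\ P \in unitmx,
    H = invmx P *m diag_mx d *m P,
    P *m H *m P^t* = diag_mx d & forall i, d 0 i \is Num.real].
Proof.
move=> Hherm; have Hh : H \is hermsymmx.
  by apply/is_hermitianmxP; rewrite expr0 scale1r Hherm.
have /orthomx_spectralP E := hermitian_normalmx Hh.
have Pu := spectral_unit H.
exists (spectralmx H), (spectral_diag H); split=> //.
  rewrite -invmx_unitary ?spectral_unitarymx // {2}E !mulmxA mulmxV // mul1mx.
  by rewrite mulmxK.
by move=> i; move/mxOverP: (hermitian_spectral_diag_real Hh); apply.
Qed.

(** By similarity H and -H have the same eigenvalues with multiplicity, and negation exchanges the
    signs. *)
Lemma balanced_spectrum_opp {m} (H K : 'M[C]_m) : H^t* = H -> K \in unitmx ->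
  invmx K *m H *m K = - H -> balanced_spectrum H.
Proof.
move=> /hermitian_spectral[P [d [Pu HE _ _]]] Ku HK.
rewrite /balanced_spectrum.
have permH : perm_eq (spectrum_seq H) (spectrum_seq (- H)).
  by apply: prod_XsubC_eq; rewrite -!spectrum_seqP -HK char_poly_conj.
have NHE : - H = invmx P *m diag_mx (- d) *m P.
  by rewrite HE linearN /= mulmxN mulNmx.
rewrite (permP permH) NHE HE !count_spectrum_seq //.
by apply: eq_card => i; rewrite !inE mxE oppr_gt0.
Qed.

End Spectrum.

(** * Hyperbolic bases of real eigenspaces *)

Section RealEigen.
Context {C : numClosedFieldType} {k : nat} {G B : 'M[C]_k}.
Hypotheses (G_herm : G^t* = G) (G_unit : G \in unitmx).
Hypothesis B_selfadj : B *m G = G *m B^t*.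
Hypothesis B_diag : diagonalizable B.

(** Serves to compare two rescaled selections from one orthogonal family, such as its vectors of
    positive and of negative square. *)
Lemma gram_rowsub {m p q} (f : 'I_p -> 'I_m) (g : 'I_q -> 'I_m)
    (c : 'rV_p) (e : 'rV_q) (d : 'rV_m) (Y : 'M[C]_(m, k)) :
  gram G Y Y = diag_mx d ->
  gram G (diag_mx c *m rowsub f Y) (diag_mx e *m rowsub g Y) =
  \matrix_(i, j) (c 0 i * d 0 (f i) * (e 0 j)^* *+ (f i == g j)).
Proof.
move=> E; rewrite gramMl gramMr adjmx_diag.
have -> : gram G (rowsub f Y) (rowsub g Y) = mxsub f g (gram G Y Y).
  by rewrite /gram mxsub_mul -mul_rowsub_mx trmx_mxsub map_mxsub.
rewrite E mul_mx_diag mul_diag_mx; apply/matrixP=> i j; rewrite !mxE.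
by rewrite mulrnAl mulrnAr mulrA.
Qed.

Lemma hyperbolic_diag {m r} (f g : 'I_r -> 'I_m) (d : 'rV_m)
    (Y : 'M[C]_(m, k)) :
  gram G Y Y = diag_mx d -> injective f -> injective g ->
  (forall i, 0 < d 0 (f i)) -> (forall i, d 0 (g i) < 0) ->
  exists U W : 'M_(r, k),
    [/\ hyperbolic G U W, (U <= Y)%MS & (W <= Y)%MS].
Proof.
move=> E f_inj g_inj f_pos g_neg.
(* The positive rows are scaled to square 1, the negative ones to square -1. *)
pose p := diag_mx (\row_i (sqrtC (d 0 (f i)))^-1) *m rowsub f Y.
pose n := diag_mx (\row_i (sqrtC (- d 0 (g i)))^-1) *m rowsub g Y.
have sqV (x : C) : 0 < x -> (sqrtC x)^-1 * x * ((sqrtC x)^-1)^* = 1.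
  move=> x_gt0; rewrite geC0_conj ?invr_ge0 ?sqrtC_ge0 ?ltW //.
  by rewrite mulrAC -invfM -expr2 sqrtCK mulVf // gt_eqF.
have pp : gram G p p = 1%:M.
  rewrite (gram_rowsub _ _ _ _ E); apply/matrixP=> i j; rewrite !mxE inj_eq //.
  by case: eqP => //= ->; rewrite sqV.
have nn : gram G n n = - 1%:M.
  rewrite (gram_rowsub _ _ _ _ E); apply/matrixP=> i j; rewrite !mxE inj_eq //.
  case: eqP => [->|]; last by rewrite oppr0.
  have := sqV (- d 0 (g j)); rewrite oppr_gt0 g_neg mulrN mulNr => /(_ isT) <-.
  by rewrite opprK.
have pn : gram G p n = 0.
  rewrite (gram_rowsub _ _ _ _ E); apply/matrixP=> i j; rewrite !mxE.
  (* An index cannot carry both a positive and a negative square. *)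
  case: eqP => // fg; have := lt_trans (f_pos i); rewrite fg.
  by move=> /(_ _ (g_neg j)); rewrite ltxx.
have np : gram G n p = 0 by apply: gram_eq0C.
have pY : (p <= Y)%MS by rewrite mulmx_sub // rowsub_sub.
have nY : (n <= Y)%MS by rewrite mulmx_sub // rowsub_sub.
have gD (X1 X2 Z1 Z2 : 'M_(r, k)) : gram G (X1 + X2) (Z1 + Z2) =
    gram G X1 Z1 + gram G X1 Z2 + (gram G X2 Z1 + gram G X2 Z2).
  by rewrite /gram linearD /= map_mxD !mulmxDl !mulmxDr.
have gNl (X Z : 'M_(r, k)) : gram G (- X) Z = - gram G X Z.
  by rewrite /gram !mulNmx.
have gNr (X Z : 'M_(r, k)) : gram G X (- Z) = - gram G X Z.
  by rewrite /gram linearN /= map_mxN mulmxN.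
have gZr a (X Z : 'M_(r, k)) : gram G X (a *: Z) = a^* *: gram G X Z.
  by rewrite /gram adjmxZ scalemxAr.
have gZl a (X Z : 'M_(r, k)) : gram G (a *: X) Z = a *: gram G X Z.
  by rewrite /gram -!scalemxAl.
(* [p + n, p - n] = 1 + 1, hence the factor 2^-1; isotropy comes from 1 - 1 = 0. *)
exists (p + n), (2^-1 *: (p - n)); split; last 1 first.
- by rewrite scalemx_sub // addmx_sub // eqmx_opp.
- split; rewrite ?gZl ?gZr !gD ?gNl ?gNr ?pp ?nn ?pn ?np.
  + by rewrite addr0 add0r subrr.
  + by rewrite !(oppr0, opprK, addr0, add0r) subrr !scaler0.
  + rewrite oppr0 opprK addr0 add0r fmorphV rmorph_nat -mulr2n -scaler_nat.
    by rewrite scalerA mulVf ?scale1r // pnatr_eq0.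
- by rewrite addmx_sub.
Qed.

(** Spanning follows by counting: no eigenvalue of the Gram matrix vanishes, so balance gives 2r =
    m. Writing a^* beside a gives the conclusion the same shape as in the nonreal case. *)
Lemma hyperbolic_real (a : C) {m} (X : 'M[C]_(m, k)) :
  a^* = a -> row_free X -> (X :=: eigenspace B a)%MS ->
  balanced_spectrum (gram G X X) ->
  exists r (U W : 'M[C]_(r, k)), [/\ hyperbolic G U W,
    (U <= eigenspace B a)%MS, (W <= eigenspace B a^*)%MS
    & (eigenspace B a + eigenspace B a^* <= col_mx U W)%MS].
Proof.
move=> a_real Xfree XE bal; rewrite a_real.
have H_free : row_free (gram G X X).
  by apply: (gram_eigen_free G_herm G_unit B_selfadj B_diag (a := a));
     rewrite ?a_real ?XE.
have [P [d [Pu HE PHP d_real]]] := hermitian_spectral (gram_adj G_herm X X).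
(* The diagonal form is congruent to an invertible Gram matrix. *)
have d_neq0 i : d 0 i != 0.
  have : diag_mx d \in unitmx.
    rewrite -PHP !unitmx_mul Pu -row_free_unit H_free.
    by rewrite map_unitmx unitmx_tr Pu.
  by rewrite unitmxE det_diag unitfE => /prodf_neq0; apply.
move: bal; rewrite /balanced_spectrum HE !count_spectrum_seq // => card_eq.
pose r := #|[pred i | 0 < d 0 i]|.
pose f (i : 'I_r) := enum_val i.
(* [card_eq] lets the same index type number the negative entries and the positive ones. *)
pose g (i : 'I_r) := enum_val (cast_ord card_eq i).
have rrm : (r + r = m)%N.
  rewrite {2}/r card_eq -[RHS]card_ord -(cardC [pred i | 0 < d 0 i]).
  congr addn; apply: eq_card => i; rewrite !inE lt_def eq_sym d_neq0 /=.
  by rewrite real_leNgt // ?real0 // negbK.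
have [] := @hyperbolic_diag m r f g d (P *m X).
- by rewrite gramMl gramMr mulmxA.
- exact: enum_val_inj.
- by move=> i j /enum_val_inj/cast_ord_inj.
- by move=> i; have := enum_valP i; rewrite inE.
- by move=> i; have := enum_valP (cast_ord card_eq i); rewrite inE.
move=> U [W [hUW UX WX]]; exists r, U, W.
have UE : (U <= eigenspace B a)%MS by rewrite -XE (submx_trans UX) ?submxMl.
have WE : (W <= eigenspace B a)%MS by rewrite -XE (submx_trans WX) ?submxMl.
split=> //; rewrite addsmx_sub andbb.
have UWE : (col_mx U W <= eigenspace B a)%MS by rewrite col_mx_sub UE.
rewrite -(geq_leqif (mxrank_leqif_sup UWE)) (eqP (hyperbolic_free G_herm hUW)).
by rewrite rrm -XE rank_leq_row.
Qed.

End RealEigen.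

(** * Orthogonal sum over the eigenvalues *)

Section Assembly.
Context {C : numClosedFieldType} {k : nat} {G B : 'M[C]_k}.
Hypotheses (G_herm : G^t* = G).
Hypothesis B_selfadj : B *m G = G *m B^t*.

(** The pair of inequalities is stable under conjugating a or b, so all four pairs of eigenspaces
    are orthogonal. *)
Lemma gram_conj_eigenspaces (a b : C) : a != b -> a != b^* ->
  gram G (eigenspace B a + eigenspace B a^*)%MS
         (eigenspace B b + eigenspace B b^*)%MS = 0.
Proof.
move=> neq_ab neq_abC; have neqs c : (c \in [:: b; b^*]) ->
    (a != c^*) && (a^* != c^*).
  rewrite !inE (inj_eq (inv_inj conjCK)).
  by case/orP => /eqP->; rewrite ?conjCK ?neq_ab ?neq_abC.
have orth c : (c \in [:: b; b^*]) ->
    gram G (eigenspace B a + eigenspace B a^*)%MS (eigenspace B c) = 0.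
  move=> /neqs/andP[ac aCc]; apply: gram_eq0C => //.
  by apply: gram_eq0_adds => //; apply: gram_eq0C => //;
     apply: gram_eigenspace.
by apply: gram_eq0_adds => //; apply: orth; rewrite !inE eqxx ?orbT.
Qed.

(** Induction on the list: the pair of eigenspaces of its head either occurs in the tail already or
    is orthogonal to all of the tail. The vectors [d] and [e] record the eigenvalues of the rows. *)
Lemma hyperbolic_sum (rs : seq C) :
  {in rs, forall a, exists r (U W : 'M[C]_(r, k)), [/\ hyperbolic G U W,
    (U <= eigenspace B a)%MS, (W <= eigenspace B a^*)%MS
    & (eigenspace B a + eigenspace B a^* <= col_mx U W)%MS]} ->
  exists r (U W : 'M[C]_(r, k)) (d e : 'rV_r), [/\ hyperbolic G U W,
    U *m B = diag_mx d *m U, W *m B = diag_mx e *m W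
    & (col_mx U W :=:
       \sum_(a <- rs) (eigenspace B a + eigenspace B a^*))%MS].
Proof.
elim: rs => [|a rs IHrs] loc.
  exists 0, 0, 0, 0, 0; rewrite big_nil; split.
  - exact: hyperbolic_nil.
  - by rewrite mul0mx mulmx0.
  - by rewrite mul0mx mulmx0.
  - by rewrite col_mx0; apply: eqmx0.
have [|r [U [W [d [e [hUW UB WB UWE]]]]]] := IHrs.
  by move=> b rs_b; apply: loc; rewrite in_cons rs_b orbT.
(* If a or its conjugate occurs in [rs], then E_a + E_{a^*} is already covered and the families stay
   unchanged. *)
have [/hasP[b rs_b ab]|/hasPn rs_a] :=
  boolP (has [pred b | (a == b) || (a == b^*)] rs).
  exists r, U, W, d, e; split=> //; apply: (eqmx_trans UWE); apply: eqmx_sym.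
  rewrite big_cons; apply/addsmx_idPr.
  have sub_b : (eigenspace B b + eigenspace B b^* <=
      \sum_(a <- rs) (eigenspace B a + eigenspace B a^*))%MS.
    rewrite (big_nth 0) big_mkord.
    have lt_b : (index b rs < size rs)%N by rewrite index_mem.
    by rewrite (sumsmx_sup (Ordinal lt_b)) ?nth_index.
  apply: submx_trans sub_b; case/orP: ab => /eqP -> //.
  by rewrite conjCK addsmxC.
have [r' [U' [W' [hUW' U'a W'a UW'E]]]] := loc a (mem_head _ _).
exists (r' + r)%N, (col_mx U' U), (col_mx W' W),
  (row_mx (const_mx a) d), (row_mx (const_mx a^*) e).
have UW'sub : (col_mx U' W' <= eigenspace B a + eigenspace B a^*)%MS.
  by rewrite -addsmxE addsmxS.
split.
- apply: hyperbolic_cat => //; apply: (gram_eq0_sub UW'sub (_ : _ <= _)%MS).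
    by rewrite UWE.
  apply: gram_eq0_sums => // b rs_b; have /= := rs_a _ rs_b.
  by rewrite negb_or => /andP[]; apply: gram_conj_eigenspaces.
- rewrite diag_mx_row mul_col_mx mul_block_col !mul0mx addr0 add0r -UB.
  by rewrite diag_const_mx mul_scalar_mx; move/eigenspaceP: U'a => ->.
- rewrite diag_mx_row mul_col_mx mul_block_col !mul0mx addr0 add0r -WB.
  by rewrite diag_const_mx mul_scalar_mx; move/eigenspaceP: W'a => ->.
(* Only the order of the four blocks differs from that of the two joined families. *)
rewrite big_cons; apply/eqmxP.
have sub_l p q m (X : 'M[C]_(p, k)) (Y : 'M_(q, k)) (Z : 'M_(m, k)) :
    (Z <= X)%MS -> (Z <= col_mx X Y)%MS.
  by move=> ZX; rewrite -addsmxE (submx_trans ZX) ?addsmxSl.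
have sub_r p q m (X : 'M[C]_(p, k)) (Y : 'M_(q, k)) (Z : 'M_(m, k)) :
    (Z <= Y)%MS -> (Z <= col_mx X Y)%MS.
  by move=> ZY; rewrite -addsmxE (submx_trans ZY) ?addsmxSr.
apply/andP; split.
  set E := (eigenspace B a + _)%MS in UW'sub *; set T := (\sum_(b <- rs) _)%MS.
  have: (col_mx U W <= E + T)%MS by rewrite UWE addsmxSr.
  have: (col_mx U' W' <= E + T)%MS by apply: submx_trans UW'sub (addsmxSl _ _).
  rewrite !col_mx_sub => /andP[sU' sW'] /andP[sU sW].
  by rewrite sU' sU sW' sW.
rewrite addsmx_sub -UWE; apply/andP; split.
  apply: submx_trans UW'E _; rewrite col_mx_sub; apply/andP; split.
    by apply/sub_l/sub_l.
  by apply/sub_r/sub_l.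
rewrite col_mx_sub; apply/andP; split.
  by apply/sub_l/sub_r.
by apply/sub_r/sub_r.
Qed.

End Assembly.

(** * Diagonalizability, eigenspaces and spectra under transposition and scaling *)

Lemma diagonalizableE {F : fieldType} {m} (A : 'M[F]_m) :
  diagonalizable A <->
  exists P (d : 'rV_m), P \in unitmx /\ P *m A = diag_mx d *m P.
Proof.
split=> [[P Pu /diagonalizable_forPex[d /(similarP Pu) E]]|[P [d [Pu E]]]].
  by exists P, d.
by exists P => //; apply/diagonalizable_forPex; exists d; apply/(similarP Pu).
Qed.

(** Transposing P A = D P shows that the inverse of P^T diagonalizes A^T. *)
Lemma diagonalizable_tr {F : fieldType} {m} (A : 'M[F]_m) :
  diagonalizable A -> diagonalizable A^T.
Proof.
move=> /diagonalizableE[P [d [Pu E]]]; apply/diagonalizableE.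
exists (invmx P^T), d; rewrite unitmx_inv unitmx_tr; split=> //.
have PTu : P^T \in unitmx by rewrite unitmx_tr.
apply: (can_inj (mulKmx PTu)); rewrite mulKVmx // mulmxA.
rewrite -[diag_mx d]tr_diag_mx -trmx_mul -E trmx_mul.
by rewrite mulmxK.
Qed.

Lemma diagonalizableZ {F : fieldType} {m} (c : F) (A : 'M[F]_m) :
  diagonalizable A -> diagonalizable (c *: A).
Proof.
move=> /diagonalizableE[P [d [Pu E]]]; apply/diagonalizableE.
exists P, (c *: d); split=> //.
by rewrite -scalemxAr E linearZ -scalemxAl.
Qed.

Lemma eigenspaceZ {F : fieldType} {m} (c a : F) (A : 'M[F]_m) : c != 0 ->
  (eigenspace (c *: A) (c * a) :=: eigenspace A a)%MS.
Proof.
move=> c_neq0; apply/eqmxP/andP; split; apply/eigenspaceP.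
  have /eigenspaceP := submx_refl (eigenspace (c *: A) (c * a)).
  by rewrite -scalemxAr -scalerA => /(scalerI c_neq0).
rewrite -scalemxAr -scalerA; congr (_ *: _).
by apply/eigenspaceP.
Qed.

(** The characteristic polynomial is invariant under transposition; passing from columns to rows
    transposes the Gram matrix. *)
Lemma balanced_spectrum_tr {C : numClosedFieldType} {m} (H : 'M[C]_m) :
  balanced_spectrum H^T <-> balanced_spectrum H.
Proof.
suff E : char_poly H^T = char_poly H.
  by rewrite /balanced_spectrum /spectrum_seq E.
rewrite -[RHS]det_tr /char_poly /char_poly_mx linearB /= tr_scalar_mx.
by rewrite map_trmx.
Qed.

(** * The flip matrix, and balance from a perplectic diagonalization *)

Section Flip.
Context {C : numClosedFieldType}.

Lemma tr_flipmx m : (flipmx C m)^T = flipmx C m.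
Proof.
apply/matrixP => i j; rewrite !mxE; congr (nat_of_bool _)%:R.
by rewrite eq_sym (can2_eq (@rev_ordK m) (@rev_ordK m)).
Qed.

Lemma conj_flipmx m : map_mx Num.conj (flipmx C m) = flipmx C m.
Proof. by apply/matrixP => i j; rewrite !mxE rmorph_nat. Qed.

Lemma flipmxK m : flipmx C m *m flipmx C m = 1%:M.
Proof.
apply/matrixP => i j; rewrite !mxE (bigD1 (rev_ord i)) //= big1 => [|l neq_l].
  by rewrite !mxE eqxx mul1r addr0 rev_ordK eq_sym.
by rewrite !mxE (negPf neq_l) mul0r.
Qed.

Lemma flipmx_unit m : flipmx C m \in unitmx.
Proof. by case/mulmx1_unit: (flipmxK m). Qed.

Lemma gram_flipmx_tr {m p q} (X : 'M[C]_(m, p)) (Y : 'M[C]_(m, q)) :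
  gram (flipmx C m) X^T Y^T = (Y^t* *m flipmx C m *m X)^T.
Proof. by rewrite /gram !trmx_mul tr_flipmx map_trmx !trmxK mulmxA. Qed.

(** Since J is an involution, S^t* J S = J says that J S^t* J is a left inverse of S. *)
Lemma perplecticP {n} (S : 'M[C]_(n + n)) :
  perplectic S <-> gram (flipmx C (n + n)) S^T S^T = flipmx C (n + n).
Proof.
rewrite gram_flipmx_tr; split=> [[Su SE]|E].
  apply: trmx_inj; rewrite trmxK tr_flipmx.
  apply: (can_inj (mulKmx (flipmx_unit _))).
  by rewrite !mulmxA SE mulVmx // flipmxK.
have {E} : flipmx C (n + n) *m S^t* *m flipmx C (n + n) *m S = 1%:M.
  by rewrite -!mulmxA [S^t* *m _]mulmxA -[_ *m _ *m S]trmxK E tr_flipmx flipmxK.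
move=> E; have [_ Su] := mulmx1_unit E; split=> //.
by apply: (can_inj (mulmxK Su)); rewrite E mulVmx.
Qed.

Lemma perplectic_diagonalizableZ {n} (c : C) (A : 'M[C]_(n + n)) :
  perplectic_diagonalizable A -> perplectic_diagonalizable (c *: A).
Proof.
move=> [S [S_perp /is_diag_mxP S_diag]]; exists S; split=> //.
rewrite -scalemxAr -scalemxAl; apply/is_diag_mxP => i j neq_ij.
by rewrite mxE S_diag ?mulr0.
Qed.

(** The basis consists of the columns of S whose diagonal entry is l. As l is an arbitrary scalar,
    this serves both parts of the theorem. *)
Lemma perplectic_diagonalizable_balanced {n} (A : 'M[C]_(n + n)) (l : C) :
  perplectic_diagonalizable A ->
  exists m (V : 'M[C]_(n + n, m)),
    eigenbasis A l V /\ balanced_spectrum (V^t* *m flipmx C (n + n) *m V).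
Proof.
move=> [S [S_perp /diag_mxP[d SE]]].
have S_gram := (perplecticP S).1 S_perp; have [Su _] := S_perp.
pose T := S^T; have Tu : T \in unitmx by rewrite unitmx_tr.
have TB : T *m A^T = diag_mx d *m T.
  by rewrite -[diag_mx d]tr_diag_mx -SE -!trmx_mul !mulmxA mulmxV // mul1mx.
pose f (i : 'I_#|[pred i | d 0 i == l]|) := enum_val i.
have fE i : d 0 (f i) = l by have := enum_valP i; rewrite inE => /eqP.
exists _, (rowsub f T)^T; split.
  split; rewrite trmxK.
    apply/row_freeP; exists (invmx T *m (rowsub f 1%:M)^T).
    rewrite mulmxA rowsubE mulmxK // trmx_mxsub trmx1 -mxsub_mul mulmx1.
    by apply/matrixP => i j; rewrite !mxE (inj_eq enum_val_inj).
  apply/eqmxP/andP; split.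
    apply/eigenspaceP/row_matrixP => i.
    rewrite mul_rowsub_mx TB row_rowsub row_mul row_diag_mx.
    by rewrite fE linearZ /= row_rowsub -scalemxAl -rowE.
  (* Expand an eigenvector in the basis [T], with coordinates [y]: those at which [d 0 j] differs
     from l vanish. *)
  apply/row_subP => i; set x := row i _.
  have xE : x *m A^T = l *: x by apply/eigenspaceP; apply: row_sub.
  pose y := x *m invmx T; have xy : x = y *m T by rewrite mulmxKV.
  rewrite xy mulmx_sum_row; apply: summx_sub => j _.
  have [dj|neq_dj] := eqVneq (d 0 j) l.
    have jP : j \in [pred i | d 0 i == l] by rewrite inE dj.
    rewrite scalemx_sub // -[j](enum_rankK_in jP jP) -[enum_val _]/(f _).
    by rewrite -row_rowsub row_sub.
  have : y *m diag_mx d = l *: y.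
    apply: (can_inj (mulmxK Tu)).
    by rewrite -mulmxA -TB mulmxA -xy xE -scalemxAl -xy.
  move/matrixP/(_ 0 j)/eqP; rewrite mul_mx_diag !mxE mulrC -subr_eq0 -mulrBl.
  rewrite mulf_eq0 subr_eq0 (negPf neq_dj) /= => /eqP ->.
  by rewrite scale0r sub0mx.
apply/balanced_spectrum_tr; rewrite -gram_flipmx_tr trmxK.
have -> : gram (flipmx C (n + n)) (rowsub f T) (rowsub f T) =
    mxsub f f (flipmx C (n + n)).
  rewrite -[in RHS]S_gram /gram mxsub_mul -mul_rowsub_mx.
  by rewrite trmx_mxsub map_mxsub.
(* The sign tells in which half an index lies; [rev_ord] exchanges the halves, so conjugation
   negates every nonzero entry of the submatrix. *)
pose K : 'M[C]_#|[pred i | d 0 i == l]| :=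
  diag_mx (\row_i (-1) ^+ (f i < n)%N).
have KK : K *m K = 1%:M.
  rewrite mulmx_diag; apply/matrixP => i j; rewrite !mxE.
  by case: eqP => // ->; rewrite -expr2 sqrr_sign.
have [Ku _] := mulmx1_unit KK.
have KV : invmx K = K by apply: (can_inj (mulKmx Ku)); rewrite mulmxV.
apply: (balanced_spectrum_opp (K := K)) => //.
  by rewrite trmx_mxsub map_mxsub tr_flipmx conj_flipmx.
rewrite KV mul_diag_mx mul_mx_diag; apply/matrixP => i j; rewrite !mxE.
case: eqP => [->|_]; last by rewrite mulr0 mul0r oppr0.
have -> : (rev_ord (f i) < n)%N = ~~ (f i < n)%N.
  by rewrite /= -leqNgt; have := ltn_ord (f i); lia.
by case: (f i < n)%N; rewrite /= ?expr0 ?expr1 !(mulr1, mul1r).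
Qed.

End Flip.

(** * From balanced eigenspaces to a perplectic diagonalization *)

Section Backward.
Context {C : numClosedFieldType}.

(** Reversing the rows of [W], and [e] along with them, turns the Gram matrix into J; the transpose
    of the resulting family is the perplectic matrix. *)
Lemma perplectic_diagonalizable_hyperbolic {n} (A : 'M[C]_(n + n))
    {r} (U W : 'M[C]_(r, n + n)) (d e : 'rV_r) :
  hyperbolic (flipmx C (n + n)) U W ->
  U *m A^T = diag_mx d *m U -> W *m A^T = diag_mx e *m W ->
  row_full (col_mx U W) -> perplectic_diagonalizable A.
Proof.
move=> hUW UA WA UWfull.
have J_herm : (flipmx C (n + n))^t* = flipmx C (n + n).
  by rewrite tr_flipmx conj_flipmx.
(* A family of 2r rows in dimension 2n is both free and full. *)
have rn : r = n.
  have /eqP := hyperbolic_free J_herm hUW; rewrite (eqP UWfull).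
  by rewrite !addnn => /double_inj.
subst r; pose T := col_mx U (flipmx C n *m W).
have [UU WW UW] := hUW.
have WU : gram (flipmx C (n + n)) W U = 1%:M.
  by rewrite -(gram_adj J_herm) UW adjmx1.
have TT : gram (flipmx C (n + n)) T T = flipmx C (n + n).
  rewrite gram_col_mx !gramMl !gramMr UU UW WU WW tr_flipmx conj_flipmx.
  by rewrite !(mul1mx, mulmx1, mul0mx, mulmx0) -flipmx_block.
pose e' := (\row_j e 0 (rev_ord j)).
have JWA : (flipmx C n *m W) *m A^T = diag_mx e' *m (flipmx C n *m W).
  rewrite -mulmxA WA !mulmxA; congr (_ *m _); rewrite mul_mx_diag mul_diag_mx.
  apply/matrixP => i j; rewrite !mxE.
  by case: eqP => [->|_]; rewrite ?rev_ordK ?mulr1 ?mul1r // mulr0 mul0r.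
have TA : T *m A^T = diag_mx (row_mx d e') *m T.
  by rewrite diag_mx_row mul_col_mx mul_block_col !mul0mx addr0 add0r UA JWA.
have T_perp : perplectic T^T by apply/perplecticP; rewrite trmxK.
exists T^T; split=> //; have [Tu _] := T_perp.
have AT : A *m T^T = T^T *m diag_mx (row_mx d e').
  by rewrite -[A]trmxK -trmx_mul TA trmx_mul tr_diag_mx.
by rewrite -mulmxA AT mulKmx // diag_mx_is_diag.
Qed.

(** Each scalar of the eigenspace decomposition of A^T supplies a hyperbolic pair: by duality if it
    is nonreal, by balance if it is a real eigenvalue. *)
Lemma per_hermitian_perplectic_diagonalizable {n} (A : 'M[C]_(n + n)) :
  diagonalizable A -> per_hermitian A ->
  (forall l, col_eigenvalue A l -> l \is Num.real ->
     exists m (V : 'M[C]_(n + n, m)), eigenbasis A l V /\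
       balanced_spectrum (V^t* *m flipmx C (n + n) *m V)) ->
  perplectic_diagonalizable A.
Proof.
move=> A_diag A_per balanced.
have J_herm : (flipmx C (n + n))^t* = flipmx C (n + n).
  by rewrite tr_flipmx conj_flipmx.
have J_unit := @flipmx_unit C (n + n).
have selfadj : A^T *m flipmx C (n + n) = flipmx C (n + n) *m A^T^t*.
  rewrite -[in LHS]A_per !trmx_mul tr_flipmx map_trmx trmxK mulmxA.
  by rewrite -[LHS]mulmxA flipmxK mulmx1.
have AT_diag := diagonalizable_tr A_diag.
have /diagonalizablePeigen[rs _ rsP] := AT_diag.
have [|r [U [W [d [e [hUW UA WA UWE]]]]]] :=
    @hyperbolic_sum _ _ _ _ J_herm selfadj rs; last first.
  apply: (perplectic_diagonalizable_hyperbolic hUW UA WA).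
  rewrite -sub1mx UWE -rsP.
  (* The eigenspaces E_a already fill the space, hence so does the sum of the E_a + E_{a^*}. *)
  elim: (rs) => [|a s IHs]; first by rewrite big_nil sub0mx.
  by rewrite !big_cons addsmxS // addsmxSl.
move=> a _.
have [/CrealP a_real|a_nonreal] := boolP (a \is Num.real); last first.
  apply: hyperbolic_nonreal => //.
  by apply: contra a_nonreal => /eqP a_real; apply/CrealP.
(* A real scalar with zero eigenspace contributes an empty pair. *)
have [a_eig|/negPn/eqP a_eig] := boolP (eigenvalue A^T a); last first.
  exists 0, 0, 0; rewrite a_real a_eig !sub0mx; split=> //.
    exact: hyperbolic_nil.
  by rewrite addsmx0 sub0mx.
have [m [V [[Vfree VE] V_bal]]] :=
  balanced a a_eig (introT (@CrealP _ a) a_real).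
apply: (hyperbolic_real J_herm J_unit selfadj AT_diag a_real Vfree VE).
by rewrite gram_flipmx_tr; apply/balanced_spectrum_tr.
Qed.

Lemma eigenbasisZ {k m} (c a : C) (A : 'M[C]_k) (V : 'M[C]_(k, m)) : c != 0 ->
  eigenbasis A a V -> eigenbasis (c *: A) (c * a) V.
Proof.
move=> c_neq0 [Vfree VE]; split=> //; apply: eqmx_trans VE _.
by rewrite linearZ /=; apply/eqmx_sym/eigenspaceZ.
Qed.

Lemma col_eigenvalueZ {k} (c a : C) (A : 'M[C]_k) : c != 0 ->
  col_eigenvalue (c *: A) (c * a) -> col_eigenvalue A a.
Proof.
move=> c_neq0; rewrite /col_eigenvalue /eigenvalue linearZ /=.
by rewrite -!mxrank_eq0 eigenspaceZ.
Qed.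

(** Conjugation sends i to -i, which cancels the sign in the perskew condition. *)
Lemma perskew_hermitianZi {n} (A : 'M[C]_(n + n)) :
  perskew_hermitian A -> per_hermitian ('i *: A).
Proof.
move=> A_skew; rewrite /per_hermitian adjmxZ conjCi -scalemxAr -scalemxAl.
by rewrite A_skew scaleNr scalerN opprK.
Qed.

(** Multiplication by i makes purely imaginary eigenvalues real and keeps the eigenspaces; dividing
    by i afterwards keeps the diagonalizing matrix. *)
Lemma perskew_hermitian_perplectic_diagonalizable {n} (A : 'M[C]_(n + n)) :
  diagonalizable A -> perskew_hermitian A ->
  (forall l, col_eigenvalue A l -> 'Re l = 0 ->
     exists m (V : 'M[C]_(n + n, m)), eigenbasis A l V /\
       balanced_spectrum (V^t* *m flipmx C (n + n) *m V)) ->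
  perplectic_diagonalizable A.
Proof.
move=> A_diag A_skew balanced.
rewrite -[A]scale1r -(mulVf (neq0Ci C)) -scalerA.
apply/perplectic_diagonalizableZ/per_hermitian_perplectic_diagonalizable.
- exact: diagonalizableZ.
- exact: perskew_hermitianZi.
move=> l; rewrite -[l](mulVKf (neq0Ci C)); set a := 'i^-1 * l.
move=> /(col_eigenvalueZ (neq0Ci C)) a_eig ia_real.
(* Re a = Im (i a), and i a is real. *)
have a_im : 'Re a = 0.
  by rewrite -ImMil; apply/Creal_ImP.
have [m [V [Va V_bal]]] := balanced a a_eig a_im.
by exists m, V; split=> //; apply: eigenbasisZ => //; apply: neq0Ci.
Qed.

End Backward.

(** * The equivalences for both classes of matrices *)

Theorem theorem2 (R : realType) (n : nat) (A : 'M[R[i]]_(n + n)) :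
  diagonalizable A ->
  (per_hermitian A ->
     (perplectic_diagonalizable A <->
      forall l : R[i], col_eigenvalue A l -> l \is Num.real ->
        exists (m : nat) (V : 'M[R[i]]_(n + n, m)),
          eigenbasis A l V /\
          balanced_spectrum (V^t* *m flipmx R[i] (n + n) *m V)))
  /\
  (perskew_hermitian A ->
     (perplectic_diagonalizable A <->
      forall l : R[i], col_eigenvalue A l -> 'Re l = 0 ->
        exists (m : nat) (V : 'M[R[i]]_(n + n, m)),
          eigenbasis A l V /\
          balanced_spectrum (V^t* *m flipmx R[i] (n + n) *m V))).
Proof.
move=> A_diag; split=> A_per; split.
- by move=> A_pd l _ _; apply: perplectic_diagonalizable_balanced.
- exact: per_hermitian_perplectic_diagonalizable.
- by move=> A_pd l _ _; apply: perplectic_diagonalizable_balanced.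
- exact: perskew_hermitian_perplectic_diagonalizable.
Qed.
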